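(* Let $p>2$ be a prime number and let $B$ be a left cancellative left semi-brace of size $2p^2$. Suppose that $|E|=2$ and $(G,\circ)$ is cyclic, and let $\alpha$ be the injective homomorphism from $(\mathbb{Z}/2\mathbb{Z},+)$ to $\mathrm{Aut}(\mathbb{Z}/p^2\mathbb{Z},+)$. Then, up to isomorphism, $B$ is one of the following left semi-braces, each with underlying set $\mathbb{Z}/p^2\mathbb{Z}\times\mathbb{Z}/2\mathbb{Z}$, with $E=\{0\}\times\mathbb{Z}/2\mathbb{Z}$, $G=\mathbb{Z}/p^2\mathbb{Z}\times\{0\}$, with addition $(g_1,e_1)+(g_2,e_2)=(g_1+g_2,e_2)$, and with multiplication given for all $(g_1,e_1),(g_2,e_2)\in B$ by: 1) $(g_1,e_1)\circ(g_2,e_2)=(g_1+\alpha_{e_1}(g_2),e_1+e_2)$; 2) $(g_1,e_1)\circ(g_2,e_2)=(g_1+g_2,e_1+e_2)$; 3) $(g_1,e_1)\circ(g_2,e_2)=(g_1+g_2+pg_1g_2,e_1+e_2)$.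
   Context: A left semi-brace is a triple $(B,+,\circ)$ where $(B,+)$ is a semigroup, $(B,\circ)$ is a group and $a\circ(b+c)=a\circ b+a\circ(a^-+c)$ for all $a,b,c\in B$, where $a^-$ is the inverse of $a$ in $(B,\circ)$ and $\circ$ has higher precedence than $+$. It is left cancellative if $(B,+)$ is left cancellative. The neutral element of $(B,\circ)$ is denoted by $0$. For a left cancellative left semi-brace $B$, $G:=B+0=\{b+0\mid b\in B\}$, which is a subgroup of $(B,\circ)$, and $E$ is the set of idempotents of $(B,+)$, which is also a subgroup of $(B,\circ)$. Isomorphisms are bijections preserving both operations. Inside the components, $+$ and products are the usual modular operations. The homomorphism $\alpha$ is the unique injective one, $\alpha_e(g)=(-1)^e g$. *)

(* Defs.v *)
From HB Require Import structures.
From mathcomp Require Import all_boot all_fingroup all_algebra all_solvable ring.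

Set Implicit Arguments.
Unset Strict Implicit.
Unset Printing Implicit Defensive.

Import GroupScope GRing.Theory.

Reserved Notation "x [+] y" (at level 50, left associativity).

(* The circle operation is the group law x * y, with inverse x^-1; its neutral
   element, traditionally written 0, is therefore 1. The semigroup operation
   x [+] y, traditionally written x + y, is neither commutative nor unital. *)
HB.mixin Record isLeftSemiBrace B of monoid.Group B := {
  sbadd : B -> B -> B;
  sbaddA : associative sbadd;
  sbmulD : forall a b c : B,
    a * sbadd b c = sbadd (a * b) (a * sbadd a^-1 c)
}.

#[short(type="leftSemiBraceType")]
HB.structure Definition LeftSemiBrace :=
  {B of isLeftSemiBrace B & monoid.Group B}.

#[short(type="finLeftSemiBraceType")]
HB.structure Definition FinLeftSemiBrace :=
  {B of LeftSemiBrace B & Finite B}.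

Notation "x [+] y" := (sbadd x y) : group_scope.

Definition left_cancellative (B : leftSemiBraceType) : Prop :=
  forall a b c : B, a [+] b = a [+] c -> b = c.

Definition sb_isomorphic (B C : leftSemiBraceType) : Prop :=
  exists f : B -> C,
    [/\ bijective f,
        {morph f : x y / x [+] y}
      & {morph f : x y / x * y}].

Definition sb_G (B : finLeftSemiBraceType) : {set B} :=
  [set b [+] 1 | b in [set: B]].

Definition sb_E (B : finLeftSemiBraceType) : {set B} :=
  [set b | b [+] b == b].

Definition ZxZ2 (p : nat) : finType := ('Z_(p ^ 2) * 'Z_2)%type.

Definition model_add (p : nat) (x y : ZxZ2 p) : ZxZ2 p := (x.1 + y.1, y.2)%R.
Definition model_one (p : nat) : ZxZ2 p := (0, 0)%R.

Fact model_addA p : associative (@model_add p).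
Proof. by move=> x y z; rewrite /model_add /= addrA. Qed.

Fact add_opp_mid (V : zmodType) (x y u v : V) :
  (x + y = 0 -> u + v = u + (x + (y + v)))%R.
Proof. by move=> xy0; rewrite (addrA x) xy0 add0r. Qed.

Section Model1.

Variables (p : nat) (alpha : {morphism [set: 'Z_2] >-> {perm 'Z_(p ^ 2)}}).

Definition mul1 (x y : ZxZ2 p) : ZxZ2 p := (x.1 + alpha x.2 y.1, x.2 + y.2)%R.
Definition inv1 (x : ZxZ2 p) : ZxZ2 p := (- alpha (- x.2)%R x.1, - x.2)%R.

Hypothesis alphaA : alpha @* [set: 'Z_2] \subset Aut [set: 'Z_(p ^ 2)].

Fact alphaD e (g h : 'Z_(p ^ 2)) :
  alpha e (g + h)%R = (alpha e g + alpha e h)%R.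
Proof.
have Ae : alpha e \in Aut [set: 'Z_(p ^ 2)].
  by apply: (subsetP alphaA); apply: mem_morphim; rewrite inE.
by apply: (morphicP (Aut_morphic Ae)); rewrite inE.
Qed.

Fact alpha_add e f (g : 'Z_(p ^ 2)) : alpha (e + f)%R g = alpha e (alpha f g).
Proof.
rewrite addrC; have -> : alpha (f + e)%R = alpha f * alpha e.
  by apply: (morphM alpha); rewrite inE.
by rewrite permM.
Qed.

Fact alpha_zero (g : 'Z_(p ^ 2)) : alpha 0%R g = g.
Proof. by have -> : alpha 0%R = 1 by [exact: morph1]; rewrite perm1. Qed.

Fact mul1A : associative mul1.
Proof. by move=> x y z; rewrite /mul1 /= alphaD alpha_add !addrA. Qed.

Fact mul11 : left_id (model_one p) mul1.
Proof. by case=> g e; rewrite /mul1 /= alpha_zero !add0r. Qed.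

Fact mul1V : left_inverse (model_one p) inv1 mul1.
Proof. by case=> g e; rewrite /mul1 /= !addNr. Qed.

(* The proof that alpha takes its values in the automorphisms is an argument,
   because without it mul1 need not be a group law. *)
Definition model1 : Type := let _ := alphaA in ZxZ2 p.

HB.instance Definition _ := Finite.copy model1 (ZxZ2 p).
HB.instance Definition _ := Finite_isGroup.Build model1 mul1A mul11 mul1V.

Fact model1_mulD (a b c : model1) :
  a * (model_add b c : model1) =
    model_add (a * b) (a * (model_add a^-1 c : model1)).
Proof.
have /(congr1 fst)/= aV : a * a^-1 = 1 by rewrite mulgV.
by congr pair; rewrite /= !alphaD addrA; exact: add_opp_mid.
Qed.

HB.instance Definition _ :=
  isLeftSemiBrace.Build model1 (@model_addA p) model1_mulD.

End Model1.

Section Model2.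

Variable p : nat.

Definition mul2 (x y : ZxZ2 p) : ZxZ2 p := (x.1 + y.1, x.2 + y.2)%R.
Definition inv2 (x : ZxZ2 p) : ZxZ2 p := (- x.1, - x.2)%R.

Fact mul2A : associative mul2.
Proof. by move=> x y z; rewrite /mul2 /= !addrA. Qed.

Fact mul21 : left_id (model_one p) mul2.
Proof. by case=> g e; rewrite /mul2 /= !add0r. Qed.

Fact mul2V : left_inverse (model_one p) inv2 mul2.
Proof. by case=> g e; rewrite /mul2 /= !addNr. Qed.

Definition model2 : Type := ZxZ2 p.

HB.instance Definition _ := Finite.copy model2 (ZxZ2 p).
HB.instance Definition _ := Finite_isGroup.Build model2 mul2A mul21 mul2V.

Fact model2_mulD (a b c : model2) :
  a * (model_add b c : model2) =
    model_add (a * b) (a * (model_add a^-1 c : model2)).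
Proof. by congr pair; rewrite /= addrA; apply: add_opp_mid; rewrite addrN. Qed.

HB.instance Definition _ :=
  isLeftSemiBrace.Build model2 (@model_addA p) model2_mulD.

End Model2.

Section Model3.

Variable p : nat.

Definition mul3 (x y : ZxZ2 p) : ZxZ2 p :=
  (x.1 + y.1 + p%:R * x.1 * y.1, x.2 + y.2)%R.
Definition inv3 (x : ZxZ2 p) : ZxZ2 p :=
  (- x.1 + p%:R * x.1 ^+ 2, - x.2)%R.

Hypothesis p_pr : prime p.

Fact pp0 : (p%:R * p%:R = 0 :> 'Z_(p ^ 2))%R.
Proof.
rewrite -natrM mulnn; apply: pchar_Zp.
by rewrite -(exp1n 2) ltn_exp2r ?prime_gt1.
Qed.

Fact ppM (x : 'Z_(p ^ 2)) : (p%:R * (p%:R * x) = 0)%R.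
Proof. by rewrite mulrA pp0 mul0r. Qed.

Fact mul3A : associative mul3.
Proof. by move=> x y z; rewrite /mul3 /= !addrA; congr pair; ring. Qed.

Fact mul31 : left_id (model_one p) mul3.
Proof. by case=> g e; rewrite /mul3 /= mulr0 mul0r addr0 !add0r. Qed.

Fact mul3V : left_inverse (model_one p) inv3 mul3.
Proof.
case=> g e; rewrite /mul3 /= addNr; congr pair.
transitivity (p%:R * (p%:R * (g ^+ 3)))%R; last exact: ppM.
ring.
Qed.

(* Primality gives p ^ 2 > 1, so that 'Z_(p ^ 2) is the ring of integers modulo
   p ^ 2; mul3 is a group law because p * p = 0 there. *)
Definition model3 : Type := let _ := p_pr in ZxZ2 p.

HB.instance Definition _ := Finite.copy model3 (ZxZ2 p).
HB.instance Definition _ := Finite_isGroup.Build model3 mul3A mul31 mul3V.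

Fact model3_mulD (a b c : model3) :
  a * (model_add b c : model3) =
    model_add (a * b) (a * (model_add a^-1 c : model3)).
Proof.
have /(congr1 fst)/= aV : a * a^-1 = 1 by rewrite mulgV.
congr pair; rewrite /= -[LHS]addr0 -[X in (_ + X = _)%R]aV; ring.
Qed.

HB.instance Definition _ :=
  isLeftSemiBrace.Build model3 (@model_addA p) model3_mulD.

End Model3.

(* Main.v *)
(* Put lambda_a(b) = a o (a^- + b). Then a o b = a + lambda_a(b), lambda is an action of
   (B, o) on (B, +), and (B, o) is the exact product of G and E. As |E| = 2, G is normal,
   the non-trivial t in E acts on G by conjugation, preserving both operations, and B is
   determined by the brace G and by this involution.
   Let u generate (G, o), s = lambda_u and N = s - 1 on the abelian group (G, +) of order
   p^2. Counting fixed points gives N^2 = 0 and p N = 0, so the n-th power of u for o is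
   n u + C(n,2) N u. For n = p odd it is p u, so u also generates (G, +), and
   N u = p k u for some k. Hence a u o b u = (a + b + p k a b) u, and rescaling u
   makes k equal to 0 or 1. Finally t acts on (G, +) as 1 or -1, and -1 preserves o only
   when k = 0. *)
From HB Require Import structures.
Require Import Defs.
From mathcomp Require Import all_boot all_fingroup all_algebra all_solvable.
From mathcomp Require Import zify ring.

Set Implicit Arguments.
Unset Strict Implicit.
Unset Printing Implicit Defensive.

Import GroupScope GRing.Theory.

(** * Permutations of $p$-power order: fixed points and unipotence *)

(** The $p$-group generated by [s] acts on [S], and every orbit other than a fixed point has size
    divisible by $p$. *)
Lemma card_perm_fix (T : finType) (s : {perm T}) (p n : nat) (S : {set T}) :
  prime p -> s ^+ (p ^ n) = 1 -> {in S, forall x, s x \in S} ->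
  #|S| = #|[set x in S | s x == x]| %[mod p].
Proof.
move=> p_pr sp1 Ss; have pS : p.-group <[s]>.
  have /dvdn_pfactor : #[s] %| p ^ n by rewrite order_dvdn sp1.
  by case=> // m _ os; rewrite /pgroup -orderE os pnatX pnat_id.
have actS : [acts <[s]>, on S | 'P].
  rewrite cycle_subG; apply/astabsP => x; rewrite /= /aperm.
  apply/idP/idP => [|/Ss//] Ssx.
  have fsS : s @: S = S.
    apply/eqP; rewrite eqEcard card_imset ?leqnn ?andbT; last exact: perm_inj.
    by apply/subsetP => _ /imsetP[y Sy ->]; exact: Ss.
  by move: Ssx; rewrite -{1}fsS mem_imset //; exact: perm_inj.
rewrite (pgroup_fix_mod pS actS); congr (_ %% _); apply: eq_card => x.
rewrite in_setI inE; congr andb.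
apply/afixP/eqP => [fx|sx _ /cycleP[i ->]]; first exact: (fx _ (cycle_id s)).
rewrite /= /aperm; elim: i => [|i IHi]; first by rewrite perm1.
by rewrite expgSr permM IHi.
Qed.

Section UnipotentAutomorphism.

Variables (gT : finGroupType) (p : nat) (s : {perm gT}).
Hypotheses (p_pr : prime p) (cardT : #|gT| = (p ^ 2)%N).
Hypotheses (sM : {morph s : x y / x * y}) (sp1 : s ^+ (p ^ 2) = 1).

Lemma mulg_p2groupC (x y : gT) : x * y = y * x.
Proof.
have abT : abelian [set: gT] by apply: (card_p2group_abelian p_pr); rewrite cardsT.
by apply: (centsP abT); rewrite inE.
Qed.

(** The endomorphism $N = s - 1$ in multiplicative notation. *)
Let comm_map (x : gT) := x^-1 * s x.

Lemma comm_mapM : {in [set: gT] &, {morph comm_map : x y / x * y}}.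
Proof.
move=> x y _ _; rewrite /comm_map sM invMg (mulg_p2groupC y^-1).
by rewrite -!mulgA; congr (_ * _); rewrite !mulgA (mulg_p2groupC y^-1).
Qed.

Canonical comm_morphism := Morphism comm_mapM.

(** The two conclusions are $pN = 0$ and $N^2 = 0$. The kernel of $N$ is the fixed-point set of [s],
    of order at least $p$, so the image has order 1 or $p$; counting fixed points in an image of
    order $p$ shows that [s] fixes it pointwise. *)
Lemma unipotent_comm x :
  (x^-1 * s x) ^+ p = 1 /\ s (x^-1 * s x) = x^-1 * s x.
Proof.
have p_gt0 := prime_gt0 p_pr; have p_gt1 := prime_gt1 p_pr.
have s1 : s 1 = 1 by apply: (mulgI (s 1)); rewrite -sM !mulg1.
pose K := 'ker comm_morphism; pose M := (comm_morphism @* [set: gT])%G.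
have memK y : (y \in K) = (s y == y).
  by rewrite !inE /= /comm_map -eq_mulVg1 eq_sym.
have cardMK : (#|M| * #|K| = p ^ 2)%N.
  rewrite card_morphim setIid -cardT -cardsT mulnC.
  by apply: Lagrange; exact: subsetT.
(* The number of fixed points in [S] is a multiple of $p$, and positive because 1 is one of them. *)
have sub_fix (S : {set gT}) : #|S| %% p = 0 -> 1 \in S -> {in S, forall x, s x \in S} ->
    p <= #|[set x in S | s x == x]|.
  move=> Sp S1 Ss; have := card_perm_fix p_pr sp1 Ss.
  rewrite Sp => /esym/eqP/dvdn_leq; apply; apply/card_gt0P; exists 1.
  by rewrite inE S1 s1 eqxx.
have pK : p <= #|K|.
  have <- : #|[set x in [set: gT] | s x == x]| = #|K|.
    by apply: eq_card => y; rewrite memK !inE.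
  by apply: sub_fix; rewrite ?cardsT ?cardT ?inE ?modnMl // => y; rewrite inE.
have Mx : comm_map x \in M by apply/morphimP; exists x; rewrite ?inE.
have dvdMp : #|M| %| p.
  have /dvdn_pfactor[//|m _ oK] : #|K| %| p ^ 2 by rewrite -cardMK dvdn_mull.
  have m_gt0 : 0 < m by case: m oK pK => [|//] ->; rewrite leqNgt p_gt1.
  have : #|M| * p %| p ^ 2 by rewrite -cardMK oK dvdn_mul // dvdn_exp.
  by rewrite expnS expn1 dvdn_pmul2r.
split.
  by apply/eqP; rewrite -order_dvdn (dvdn_trans (order_dvdG Mx)).
have sMM : {in M, forall y, s y \in M}.
  move=> _ /morphimP[y _ _ ->]; rewrite /= /comm_map sM.
  have -> : s y^-1 = (s y)^-1 by apply: (mulgI (s y)); rewrite -sM !mulgV.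
  by apply/morphimP; exists (s y); rewrite ?inE.
case/primeP: (p_pr) => _ /(_ _ dvdMp)/orP[/eqP M1|/eqP Mp].
  suff -> : x^-1 * s x = 1 by [].
  by apply/set1gP; rewrite -(card1_trivg M1).
have MF := sub_fix M _ (group1 _) sMM.
have /eqP eMF : [set y in M | s y == y] == M.
  rewrite eqEcard Mp MF ?Mp ?modnn // andbT.
  by apply/subsetP => y; rewrite inE => /andP[].
by move: Mx; rewrite -eMF inE => /andP[_ /eqP].
Qed.

Hypothesis p_gt2 : 2 < p.

(* [orb n] is the n-th power of u for the operation x o y = x * s^i(y), where
   x = orb i. *)
Lemma cyclic_regular_orbit (u : gT) (orb := fun n => iter n (fun x => u * s x) 1) :
  orb p <> 1 ->
  #[u] = (p ^ 2)%N /\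
  exists k, (forall n, orb n = u ^+ (n + p * (k * 'C(n, 2)))) /\
    forall n b, (s ^+ n) (u ^+ b) = u ^+ (b + p * (k * n * b)).
Proof.
move=> orbp; have [cp1 sc] := unipotent_comm u.
set c := u^-1 * s u in cp1 sc; have su : s u = u * c by rewrite mulKVg.
have s1 : s 1 = 1 by apply: (mulgI (s 1)); rewrite -sM !mulg1.
have sX x n : s (x ^+ n) = s x ^+ n.
  by elim: n => [|n IHn]; rewrite ?expg0 ?s1 // !expgS sM IHn.
(* Since [s] fixes [c], step $n$ contributes $n$ new factors [c], and $\binom{n}{2} + n =
   \binom{n+1}{2}$. *)
have orbE n : orb n = u ^+ n * c ^+ 'C(n, 2).
  elim: n => [|n IHn]; first by rewrite bin0n mulg1.
  have -> : orb n.+1 = u * s (orb n) by [].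
  rewrite IHn sM !sX sc su expgMn; last exact: mulg_p2groupC.
  by rewrite binS bin1 addnC expgD expgS !mulgA.
have ou : #[u] = (p ^ 2)%N.
  have /dvdn_pfactor[//|m le_m2 ou] : #[u] %| p ^ 2.
    by rewrite -cardT -cardsT order_dvdG ?inE.
  have [m_lt2|m_ge2] := ltnP m 2; last by rewrite ou (@anti_leq m 2) // le_m2.
  (* As $p$ is odd it divides $\binom{p}{2}$, so [orb p] is [u ^+ p], which is 1 when [u] has order
     below $p^2$. *)
  case: orbp; rewrite orbE bin2odd; last first.
    by case/even_prime: p_pr => // p2; move: p_gt2; rewrite p2.
  rewrite expgM cp1 expg1n mulg1; apply/eqP; rewrite -order_dvdn ou.
  by case: m m_lt2 {le_m2 ou} => [|[]].
split=> //.
have genu : <[u]> = [set: gT].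
  by apply/eqP; rewrite eqEcard subsetT cardsT cardT -ou /= -orderE.
have [j cj] : exists j, c = u ^+ j by apply/cycleP; rewrite genu inE.
have /dvdnP[k jE] : p %| j.
  have : u ^+ (j * p) == 1 by rewrite expgM -cj cp1.
  by rewrite -order_dvdn ou expnS expn1 dvdn_pmul2r ?prime_gt0.
exists k; split=> [n|].
  by rewrite orbE cj jE -expgM expgD; congr (_ * _ ^+ _); lia.
elim=> [|n IHn] b; first by rewrite muln0 mul0n muln0 addn0 perm1.
rewrite expgSr permM IHn sX su cj jE -expgS -expgM.
apply/eqP; rewrite eq_expg_mod_order ou.
have -> : ((k * p).+1 * (b + p * (k * n * b)) =
          (k * k * n * b) * p ^ 2 + (b + p * (k * n.+1 * b)))%N by ring.
by rewrite modnMDl.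
Qed.

End UnipotentAutomorphism.

(** * The action $\lambda$, the subgroups $G$ and $E$, and the additive group on $G$ *)

Section LambdaMap.

Variables (B : finLeftSemiBraceType) (B_canc : left_cancellative B).

Definition sb_lambda (a b : B) : B := a * (a^-1 [+] b).

Lemma sb_add1 (b : B) : 1 [+] b = b.
Proof.
have /B_canc : 1 [+] b = 1 [+] (1 [+] b).
  by have := sbmulD (1 : B) 1 b; rewrite invg1 !mul1g.
by [].
Qed.

Lemma sb_mulE (a b : B) : a * b = a [+] sb_lambda a b.
Proof. by rewrite -[in LHS](sb_add1 b) sbmulD mulg1. Qed.

Lemma sb_lambda1 (b : B) : sb_lambda 1 b = b.
Proof. by rewrite /sb_lambda invg1 sb_add1 mul1g. Qed.

Lemma sb_lambdaM (a b c : B) : sb_lambda (a * b) c = sb_lambda a (sb_lambda b c).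
Proof. by rewrite /sb_lambda invMg -mulgA sbmulD mulKVg. Qed.

Lemma sb_lambdaD (a : B) : {morph sb_lambda a : b c / b [+] c}.
Proof. by move=> b c; rewrite /sb_lambda sbaddA sbmulD. Qed.

Lemma sb_lambdaK (a : B) : cancel (sb_lambda a) (sb_lambda a^-1).
Proof. by move=> b; rewrite -sb_lambdaM mulVg sb_lambda1. Qed.

Lemma sb_lambda_inj (a : B) : injective (sb_lambda a).
Proof. exact: can_inj (sb_lambdaK a). Qed.

Lemma sb_addE (e b : B) : e \in sb_E B -> e [+] b = b.
Proof. by rewrite inE => /eqP ee; apply: (@B_canc e); rewrite sbaddA ee. Qed.

Lemma sb_lambdaE (a e : B) : e \in sb_E B -> sb_lambda a e \in sb_E B.
Proof. by rewrite !inE => /eqP ee; rewrite -sb_lambdaD ee. Qed.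

Lemma sb_E1 : (1 : B) \in sb_E B.
Proof. by rewrite inE sb_add1. Qed.

(** Idempotents are left identities of [[+]], so on $E$ the product $a \circ b$ equals
    $\lambda_a(b)$, again an idempotent; finiteness gives inverses. *)
Lemma sb_E_group_set : group_set (sb_E B).
Proof.
apply/group_setP; split=> [|a b Ea Eb]; first exact: sb_E1.
by rewrite sb_mulE sb_addE // sb_lambdaE.
Qed.
Canonical sb_E_group := group sb_E_group_set.

Lemma mem_sb_G (a : B) : (a \in sb_G B) = (a [+] 1 == a).
Proof.
apply/imsetP/eqP => [[b _ ->]|<-]; first by rewrite -sbaddA sb_add1.
by exists a; rewrite ?inE.
Qed.

(** Compare $a + 1$ with $a = a \circ 1 = a + \lambda_a(1)$. Being the stabiliser of 1 under
    $\lambda$ makes $G$ a subgroup. *)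
Lemma sb_G_lambda1 (a : B) : (a \in sb_G B) = (sb_lambda a 1 == 1).
Proof.
rewrite mem_sb_G; apply/eqP/eqP => [a1|]; last by rewrite -{3}[a]mulg1 sb_mulE => ->.
by apply: (@B_canc a); rewrite -sb_mulE mulg1 a1.
Qed.

Lemma sb_G_group_set : group_set (sb_G B).
Proof.
apply/group_setP; split=> [|a b]; first by rewrite sb_G_lambda1 sb_lambda1.
by rewrite !sb_G_lambda1 => /eqP a1 /eqP b1; rewrite sb_lambdaM b1 a1.
Qed.
Canonical sb_G_group := group sb_G_group_set.

Lemma sb_GD (a b : B) : b \in sb_G B -> a [+] b \in sb_G B.
Proof. by rewrite !mem_sb_G -sbaddA => /eqP->. Qed.

Lemma sb_lambdaG (a b : B) :
  a \in sb_G B -> b \in sb_G B -> sb_lambda a b \in sb_G B.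
Proof.
rewrite sb_G_lambda1 !mem_sb_G => /eqP a1 /eqP b1.
by rewrite -{1}a1 -sb_lambdaD b1.
Qed.


Lemma sb_GE_TI : sb_G B :&: sb_E B = 1.
Proof.
apply/trivgP/subsetP => e /setIP[Ge Ee]; apply/set1gP.
by move: Ge; rewrite mem_sb_G sb_addE // => /eqP.
Qed.

Lemma sb_GE_mul : sb_G B * sb_E B = [set: B].
Proof.
apply/setP => b; rewrite !inE; apply/mulsgP.
have Gb : b [+] 1 \in sb_G B by rewrite mem_sb_G -sbaddA sb_add1.
set g := b [+] 1 in Gb.
(* Chosen so that $g \circ e = g + \lambda_g(e) = b + 1 + \lambda_b(1) = b \circ 1$. *)
pose e := sb_lambda g^-1 (sb_lambda b 1).
exists g e; rewrite ?sb_lambdaE ?sb_E1 //.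
rewrite sb_mulE /e -[in X in sb_lambda X _](invgK g) sb_lambdaK.
by rewrite -sbaddA sb_add1 -sb_mulE mulg1.
Qed.

(* Left cancellation is an argument because without it [+] need not be a group
   law on G. *)
Definition sb_addG : Type := let _ := B_canc in {a : B | a \in sb_G B}.

HB.instance Definition _ := SubFinite.copy sb_addG {a : B | a \in sb_G B}.

Implicit Types x y z : sb_addG.

Definition addG_mul x y : sb_addG := Sub (val x [+] val y) (sb_GD _ (valP y)).
Definition addG_one : sb_addG := Sub 1 (group1 _).
(** The additive inverse, because $x + \lambda_x(x^-) = x \circ x^- = 1$. *)
Definition addG_inv x : sb_addG :=
  Sub (sb_lambda (val x) (val x)^-1) (sb_lambdaG (valP x) (groupVr (valP x))).

Lemma addG_mulA : associative addG_mul.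
Proof. by move=> x y z; apply: val_inj; rewrite !SubK sbaddA. Qed.

Lemma addG_mul1 : left_id addG_one addG_mul.
Proof. by move=> x; apply: val_inj; rewrite !SubK sb_add1. Qed.

Lemma addG_mulV : left_inverse addG_one addG_inv addG_mul.
Proof.
have mulx1 x : addG_mul x addG_one = x.
  by apply: val_inj; rewrite !SubK; apply/eqP; rewrite -mem_sb_G (valP x).
have mulxV x : addG_mul x (addG_inv x) = addG_one.
  by apply: val_inj; rewrite !SubK -sb_mulE mulgV.
(* A right identity and right inverses suffice: with $z$ a right inverse of $y$, $y + x = y + x + (y
   + z) = y + z = 1$. *)
move=> x; set y := addG_inv x; have xy : addG_mul x y = addG_one := mulxV x.
rewrite -[LHS]mulx1 -{1}(mulxV y) addG_mulA -(addG_mulA y) xy mulx1; exact: mulxV.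
Qed.

HB.instance Definition _ := Finite_isGroup.Build sb_addG addG_mulA addG_mul1 addG_mulV.

Lemma val_addGM x y : val (x * y) = val x [+] val y.
Proof. by []. Qed.

Lemma val_addG1 : val (1 : sb_addG) = 1.
Proof. by []. Qed.

Lemma card_addG : #|{: sb_addG}| = #|sb_G B|.
Proof. exact: card_sig. Qed.

End LambdaMap.

(** An odd $p$ cannot divide both $m - 1$ and $m + 1$, so all of $p^2$ divides one of these two
    factors of $m^2 - 1$. *)
Lemma sqr_mod_prime_sqr (p m : nat) :
  prime p -> 2 < p -> m * m = 1 %[mod p ^ 2] ->
  m = 1 %[mod p ^ 2] \/ p ^ 2 %| m.+1.
Proof.
move=> p_pr p_gt2; have p_gt1 := prime_gt1 p_pr.
case: m => [|m]; first by rewrite mod0n modn_small // (ltn_exp2l 0).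
move/eqP; rewrite eqn_mod_dvd; last by lia.
have -> : (m.+1 * m.+1 - 1 = m * m.+2)%N by lia.
move=> dvd_m; have [pm|pm] := boolP (p %| m).
  left; apply/eqP; rewrite eqn_mod_dvd ?subn1 //.
  rewrite Gauss_dvdl // in dvd_m; rewrite coprime_pexpl // prime_coprime //.
  by rewrite -addn2 dvdn_addr // gtnNdvd.
by right; rewrite Gauss_dvdr // in dvd_m; rewrite coprime_pexpl // prime_coprime.
Qed.

(** * The structure of $B$ when $|E| = 2$ and $(G, \circ)$ is cyclic *)

Section CyclicG.

Variables (B : finLeftSemiBraceType) (B_canc : left_cancellative B) (p : nat).
Hypotheses (p_pr : prime p) (p_gt2 : 2 < p).
Hypotheses (cardB : #|B| = (2 * p ^ 2)%N) (cardE : #|sb_E B| = 2).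

Local Notation K := (sb_addG B_canc).
Local Notation toB := (val : K -> B).

Lemma card_sb_G : #|sb_G B| = (p ^ 2)%N.
Proof.
have := @TI_cardMg _ (sb_G_group B_canc) (sb_E_group B_canc) (sb_GE_TI B_canc).
rewrite /= sb_GE_mul // cardsT cardB cardE [(2 * _)%N]mulnC => /eqP.
by rewrite eqn_pmul2r // => /eqP/esym.
Qed.

Lemma sb_G_normal : sb_G B <| [set: B].
Proof.
apply: (@index2_normal _ _ (sb_G_group B_canc)); first exact: subsetT.
by rewrite -divgS ?subsetT //= cardsT cardB card_sb_G mulnK // expn_gt0 prime_gt0.
Qed.

Lemma sb_GJ (g t : B) : g \in sb_G B -> g ^ t \in sb_G B.
Proof. by move=> Gg; rewrite memJ_norm // (subsetP (normal_norm sb_G_normal)) ?inE. Qed.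

Lemma sb_E_involution :
  exists t : B, [/\ sb_E B = [set 1; t], t \in sb_E B, t != 1 & t * t = 1].
Proof.
have [t [E_t t_neq1]] : exists t : B, sb_E B = [set 1; t] /\ t != 1.
  have /cards2P[a [b [neq_ab eE]]] : #|sb_E B| == 2 by rewrite cardE.
  have := sb_E1 B_canc; rewrite eE !inE => /orP[]/eqP e1.
    by exists b; rewrite e1 eq_sym.
  by exists a; rewrite e1 setUC.
have Et : t \in sb_E B by rewrite E_t !inE eqxx orbT.
exists t; split=> //; have := groupM (Et : t \in sb_E_group B_canc) Et.
rewrite /= E_t !inE => /orP[/eqP//|]; rewrite -{3}[t]mulg1 => /eqP/mulgI t1.
by rewrite t1 eqxx in t_neq1.
Qed.

(** [cyclic_regular_orbit] is applied to $\lambda_u$ for a generator $u$ of $(G, \circ)$; there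
    [orb n] is the $n$-th power of $u$ for $\circ$. The coefficient [k] it yields is then normalised
    to 0 or 1. *)
Lemma cyclic_sb_G_mul :
  cyclic (sb_G B) ->
  exists (w : K) (c : bool), #[w] = (p ^ 2)%N /\
    forall a b, toB (w ^+ a) * toB (w ^+ b) = toB (w ^+ (a + b + p * (c * a * b))).
Proof.
case/cyclicP => u0 Gu; have ou0 : #[u0] = (p ^ 2)%N by rewrite orderE -Gu card_sb_G.
have Gu0 : u0 \in sb_G B by rewrite Gu cycle_id.
have lamG (x : K) : sb_lambda u0 (val x) \in sb_G B.
  by apply: sb_lambdaG => //; exact: valP.
pose u : K := Sub u0 Gu0.
pose lam (x : K) : K := Sub (sb_lambda u0 (val x)) (lamG x).
have lam_inj : injective lam.
  by move=> x y /(congr1 val) /(sb_lambda_inj B_canc) /val_inj.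
pose s := perm lam_inj.
have sE x : val (s x) = sb_lambda u0 (val x) by rewrite permE.
have sM : {morph s : x y / x * y}.
  by move=> x y; apply: val_inj; rewrite sE !val_addGM !sE sb_lambdaD.
have sXE n x : val ((s ^+ n) x) = sb_lambda (u0 ^+ n) (val x).
  elim: n => [|n IHn]; first by rewrite perm1 sb_lambda1.
  by rewrite expgSr permM sE IHn expgS sb_lambdaM.
have sp1 : s ^+ (p ^ 2) = 1.
  apply/permP => x; apply: val_inj.
  by rewrite sXE -ou0 expg_order perm1 sb_lambda1.
have cardK : #|{: K}| = (p ^ 2)%N by rewrite card_addG card_sb_G.
pose orb n := iter n (fun x => u * s x) 1.
have orbE n : val (orb n) = u0 ^+ n.
  elim: n => [|n IHn] //.
  by rewrite [orb _]iterS val_addGM sE IHn expgS [RHS]sb_mulE.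
have orbp : orb p <> 1.
  move/(congr1 val)/eqP; rewrite orbE val_addG1 -order_dvdn ou0.
  by apply/negP; rewrite gtnNdvd ?prime_gt0 // -{1}(expn1 p) ltn_exp2l // prime_gt1.
have [ou [k [orbX sX]]] := cyclic_regular_orbit p_pr cardK sM sp1 p_gt2 orbp.
(* Write [u ^+ a] as the $\circ$-power [u0 ^+ n]; then $\lambda$ acts as [s ^+ n], and $a \equiv n$
   modulo $p$ lets $a$ replace $n$ in the term $pknb$. *)
have mulu a b : val (u ^+ a) * val (u ^+ b) = val (u ^+ (a + b + p * (k * a * b))).
  have [n un] : exists n, val (u ^+ a) = u0 ^+ n.
    by apply/cycleP; rewrite -Gu (valP (u ^+ a)).
  have ua : u ^+ a = orb n by apply: val_inj; rewrite un orbE.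
  rewrite sb_mulE // {2}un -sXE sX -val_addGM -expgD; congr val.
  apply/eqP; rewrite eq_expg_mod_order ou.
  have /eqP an : a == n + p * (k * 'C(n, 2)) %[mod p ^ 2].
    by rewrite -ou -eq_expg_mod_order ua; apply/eqP; exact: orbX.
  rewrite -addnA !eqn_modDl; apply/eqP/esym.
  have -> : (p * (k * a * b) = (p * k * b) * a)%N by ring.
  rewrite -modnMmr an modnMmr.
  have -> : (p * k * b * (n + p * (k * 'C(n, 2))) =
             (k * b * k * 'C(n, 2)) * p ^ 2 + p * (k * n * b))%N by ring.
  by rewrite modnMDl.
have [pk|pk] := boolP (p %| k).
  exists u, false; split=> // a b; rewrite mulu !mul0n muln0 addn0; congr val.
  case/dvdnP: pk => j ->; apply/eqP; rewrite eq_expg_mod_order ou.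
  have -> : (a + b + p * (j * p * a * b) = (j * a * b) * p ^ 2 + (a + b))%N by ring.
  by rewrite modnMDl.
have cop_kp : coprime k p by rewrite coprime_sym prime_coprime.
(* [r] inverts [k] modulo $p$, so $pk(ra)(rb) \equiv r \cdot pab$ modulo $p^2$, and the generator
   [u ^+ r] has coefficient 1. *)
pose r := (k ^ (totient p).-1)%N.
have kr : k * r = 1 %[mod p].
  by rewrite -expnS prednK ?totient_gt0 ?prime_gt0 // Euler_exp_totient.
exists (u ^+ r), true; split=> [|a b].
  by rewrite orderXgcd ou (eqP (_ : coprime _ _)) ?divn1 //
    coprimeXl // coprime_sym coprimeXl.
rewrite -!expgM mulu; congr val; apply/eqP; rewrite eq_expg_mod_order ou.
have -> : (r * a + r * b + p * (k * (r * a) * (r * b)) =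
  r * a + r * b + p * ((r * a * b) * (k * r)))%N by ring.
have -> : (r * (a + b + p * (true * a * b)) =
  r * a + r * b + p * ((r * a * b) * 1))%N by rewrite mul1n; ring.
rewrite eqn_modDl expnS expn1 -!muln_modr eqn_pmul2l ?prime_gt0 //.
by rewrite -modnMmr kr modnMmr.
Qed.

(** $\lambda_g$ permutes the two-element set $E$ and fixes 1, hence also the other element. *)
Lemma sb_lambda_fixE (g e : B) : g \in sb_G B -> e \in sb_E B -> sb_lambda g e = e.
Proof.
have [t [E_t Et t_neq1 _]] := sb_E_involution.
move=> Gg; have lam1 : sb_lambda g 1 = 1 by apply/eqP; rewrite -sb_G_lambda1.
rewrite {1}E_t !inE => /orP[]/eqP-> //; have := sb_lambdaE g Et.
rewrite E_t !inE => /orP[] /eqP // lam_t; case/eqP: t_neq1.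
by apply: (sb_lambda_inj B_canc (a := g)); rewrite lam_t lam1.
Qed.

(* For t in E and g in G, lambda_t(g) = t o g = g^t + t; as lambda_t is additive,
   so is conjugation by t. *)
Lemma sb_GJD (t : B) :
  t \in sb_E B -> {in sb_G B &, forall g h : B, (g [+] h) ^ t = g ^ t [+] h ^ t}.
Proof.
have [t0 [E_t0 Et0 _ tt]] := sb_E_involution; rewrite E_t0 !inE => Et.
have {Et} [->|-> g h Gg Gh] : t = 1 \/ t = t0 by case/orP: Et => /eqP; tauto.
  by move=> g h _ _; rewrite !conjg1.
have t0V : t0^-1 = t0 by apply: (mulgI t0); rewrite mulgV tt.
have lamJ x : x \in sb_G B -> sb_lambda t0 x = x ^ t0 [+] t0.
  move=> Gx; have -> : sb_lambda t0 x = x ^ t0 * t0.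
    rewrite -[LHS](sb_addE B_canc _ Et0) -sb_mulE //.
    by rewrite conjgE t0V -!mulgA tt mulg1.
  by rewrite sb_mulE // sb_lambda_fixE ?sb_GJ.
(* Adding 1 strips a trailing [t0], which is a left identity of [[+]]. *)
have cancel_t0 x : x \in sb_G B -> x [+] t0 [+] 1 = x.
  by rewrite mem_sb_G // -sbaddA (sb_addE B_canc _ Et0) // => /eqP.
rewrite -(cancel_t0 ((g [+] h) ^ t0)) ?sb_GJ ?sb_GD // -lamJ ?sb_GD //.
rewrite sb_lambdaD !lamJ // -[_ [+] t0 [+] _]sbaddA (sb_addE B_canc _ Et0) // sbaddA.
by rewrite cancel_t0 // sb_GD ?sb_GJ.
Qed.

(** Conjugation by [t] is additive on $G$, so it multiplies the exponents of [w] by some [m]; as [t]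
    is an involution, $m^2 \equiv 1$ modulo $p^2$. *)
Lemma sb_structure :
  cyclic (sb_G B) ->
  exists (w : K) (t : B) (m : nat) (c : bool),
    [/\ #[w] = (p ^ 2)%N,
        [/\ t \in sb_E B, t != 1 & t * t = 1],
        (forall a b, toB (w ^+ a) * toB (w ^+ b) = toB (w ^+ (a + b + p * (c * a * b)))),
        (forall a, toB (w ^+ a) ^ t = toB (w ^+ (m * a))) &
        m = 1 %[mod p ^ 2] \/ ~~ c /\ p ^ 2 %| m.+1].
Proof.
move=> cycG; have [w [c [ow mulw]]] := cyclic_sb_G_mul cycG.
have [t [_ Et t_neq1 tt]] := sb_E_involution.
have [m wm] : exists m, Sub (toB w ^ t) (sb_GJ t (valP w)) = w ^+ m :> K.
  apply/cycleP; have /eqP -> : <[w]> == [set: K]; last by rewrite inE.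
  by rewrite eqEcard subsetT cardsT card_addG card_sb_G -ow /= -orderE.
have wJ a : toB (w ^+ a) ^ t = toB (w ^+ (m * a)).
  elim: a => [|a IHa]; first by rewrite muln0 !expg0 val_addG1 conj1g.
  rewrite expgS val_addGM sb_GJD ?(valP w) ?(valP (w ^+ a)) //.
  by rewrite IHa mulnS expgD val_addGM -wm.
have mm : m * m = 1 %[mod p ^ 2].
  apply/eqP; rewrite -ow -eq_expg_mod_order; apply/eqP/val_inj.
  by rewrite -wJ -[m]muln1 -wJ -conjgM tt conjg1.
exists w, t, m, c; split=> //.
have [|dvd_m] := sqr_mod_prime_sqr p_pr p_gt2 mm; [by left | right].
split=> //; case: c mulw => // mulw; exfalso.
(* Conjugating $w \circ w = (2 + p) w$ gives $pm^2 \equiv pm$ modulo $p^2$, so $p$ divides $m - 1$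
   as well as $m + 1$, hence 2. *)
have /(congr1 (fun x => x ^ t)) := mulw 1%N 1%N.
rewrite conjMg !wJ mulw !muln1 => /val_inj/eqP; rewrite eq_expg_mod_order ow.
have -> : (m * (1 + 1 + p) = m + m + p * m)%N by ring.
rewrite mul1n eqn_modDl expnS expn1 -!muln_modr eqn_pmul2l ?prime_gt0 //.
have pm1 : p %| m.+1 by apply: dvdn_trans dvd_m; rewrite dvdn_exp.
have m_gt0 : 0 < m.
  by case: (m) pm1; rewrite // gtnNdvd // prime_gt1.
rewrite eqn_mod_dvd ?leq_pmulr // -{3}[m]muln1 -mulnBr Gauss_dvdr; last first.
  by apply: coprime_dvdl pm1 _; exact: coprimeSn.
move=> /(dvdn_sub pm1); have -> : (m.+1 - (m - 1) = 2)%N by lia.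
by rewrite gtnNdvd.
Qed.

End CyclicG.

(** * Coordinates on $B$ and the form of $\alpha$ *)

Lemma expg_natr_Zp (gT : finGroupType) (x : gT) (n k : nat) :
  1 < n -> #[x] = n -> x ^+ (k%:R : 'Z_n)%R = x ^+ k.
Proof. by move=> n_gt1 ox; rewrite val_Zp_nat // expg_mod // -ox expg_order. Qed.

Section Models.

Variable p : nat.
Hypotheses (p_pr : prime p) (p_gt2 : 2 < p).

Let p2_gt1 : 1 < p ^ 2.
Proof. by rewrite (ltn_exp2l 0) // prime_gt1. Qed.

Lemma Zp_eq_natr (x : 'Z_(p ^ 2)) : exists a : nat, x = a%:R%R.
Proof. by exists x; rewrite natr_Zp. Qed.

Lemma natr_Zp_eq1 m : m = 1 %[mod p ^ 2] -> m%:R%R = 1%R :> 'Z_(p ^ 2).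
Proof. by move=> m1; rewrite -[RHS](mulr1n 1%R); apply: ord_inj; rewrite !val_Zp_nat. Qed.

Lemma natr_Zp_eqN1 m : p ^ 2 %| m.+1 -> m%:R%R = (-1)%R :> 'Z_(p ^ 2).
Proof.
move=> dvd_m; apply/eqP; rewrite -subr_eq0 opprK natr1.
by apply/eqP/ord_inj; rewrite val_Zp_nat //; apply/eqP.
Qed.

(** One formula for the three models: [mu] gives the action of the involution of $E$ on $G$, and
    $(\mu, c)$ is $(-1, 0)$, $(1, 0)$ or $(1, 1)$. *)
Definition twisted_mul (mu c : 'Z_(p ^ 2)) (x y : ZxZ2 p) : ZxZ2 p :=
  let z := (mu ^+ x.2 * y.1)%R in (x.1 + z + p%:R * (c * x.1 * z), x.2 + y.2)%R.

Lemma sb_coordinates (B : finLeftSemiBraceType) :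
  left_cancellative B -> #|B| = (2 * p ^ 2)%N -> #|sb_E B| = 2 ->
  cyclic (sb_G B) ->
  exists (f : ZxZ2 p -> B) (mu c : 'Z_(p ^ 2)),
    [/\ bijective f,
        {morph f : x y / model_add x y >-> x [+] y},
        {morph f : x y / twisted_mul mu c x y >-> x * y} &
        [\/ mu = (-1)%R /\ c = 0%R, mu = 1%R /\ c = 0%R | mu = 1%R /\ c = 1%R]].
Proof.
move=> B_canc cardB cardE cycG.
have [w [t [m [c [ow [Et t_neq1 tt] mulw wJ mc]]]]] :=
  sb_structure B_canc p_pr p_gt2 cardB cardE cycG.
have ot : #[t] = 2.
  have : #[t] %| 2 by rewrite order_dvdn expgS expg1 tt.
  by case/primeP: (isT : prime 2) => _ /[apply]; rewrite order_eq1 (negPf t_neq1) => /eqP.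
have EtX n : t ^+ n \in sb_E B by apply: (groupX n (Et : t \in sb_E_group B_canc)).
have wE k : w ^+ (k%:R : 'Z_(p ^ 2))%R = w ^+ k by exact: expg_natr_Zp.
have wJX l i : val (w ^+ l) ^ (t ^+ i) = val (w ^+ (m ^ i * l)).
  elim: i => [|i IHi]; first by rewrite conjg1 mul1n.
  by rewrite expgSr conjgM IHi wJ mulnA -expnS.
(* The exact factorisation $B = G \circ E$; the product is also a sum because $\lambda_g$ fixes $E$
   pointwise for $g$ in $G$. *)
pose f (x : ZxZ2 p) : B := val (w ^+ x.1) * t ^+ x.2.
have fE x : f x = val (w ^+ x.1) [+] t ^+ x.2.
  by rewrite /f sb_mulE // (sb_lambda_fixE B_canc cardE) ?(valP (w ^+ x.1)).
have f1 x : f x [+] 1 = val (w ^+ x.1).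
  rewrite fE -sbaddA (sb_addE B_canc _ (EtX _)); apply/eqP.
  by rewrite -mem_sb_G // (valP (w ^+ x.1)).
have fM a i : f (a, i) = val (w ^+ a) * t ^+ i by [].
have fE' a i : f (a, i) = val (w ^+ a) [+] t ^+ i := fE (a, i).
exists f, m%:R%R, c%:R%R; split.
- apply: inj_card_bij; last first.
    by rewrite card_prod !card_ord !Zp_cast // cardB mulnC.
  case=> [a i] [b j] fab.
  (* Adding 1 removes the $E$-component and so isolates the first coordinate. *)
  have := congr1 (fun z => z [+] 1) fab; rewrite !f1 => /val_inj/eqP /=.
  rewrite eq_expg_mod_order ow !modn_small => [/eqP ab||]; last 2 first.
  - by rewrite -{2}(Zp_cast p2_gt1) ltn_ord.
  - by rewrite -{2}(Zp_cast p2_gt1) ltn_ord.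
  move: fab; rewrite /f /= ab => /mulgI/eqP.
  rewrite eq_expg_mod_order ot !modn_small ?(ltn_ord i) ?(ltn_ord j) // => /eqP ij.
  by congr pair; apply: val_inj.
- case=> [a i] [b j]; rewrite -[model_add _ _]/((a + b)%R, j) !fE'.
  have [[k ->] [l ->]] := (Zp_eq_natr a, Zp_eq_natr b).
  rewrite -natrD !wE expgD val_addGM sbaddA -[in RHS](sbaddA _ (t ^+ i)).
  by rewrite [t ^+ i [+] _]sb_addE.
- case=> [a i] [b j]; rewrite -[twisted_mul _ _ _ _]/
    (a + m%:R ^+ i * b + p%:R * (c%:R * a * (m%:R ^+ i * b)), i + j)%R !fM.
  have [[k ->] [l ->]] := (Zp_eq_natr a, Zp_eq_natr b).
  have -> : t ^+ (i + j)%R = t ^+ i * t ^+ j.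
    by rewrite -expgD -[RHS](@expg_mod _ 2) // expgS expg1.
  rewrite -natrX -!natrM -!natrD !wE !mulgA; congr (_ * _).
  (* Moving [t ^+ i] to the right past [w ^+ l] conjugates the latter, that is, multiplies its
     exponent by [m ^ i]. *)
  have tXX : t ^+ i * t ^+ i = 1 by rewrite -expgMn ?tt ?expg1n.
  have tXV : (t ^+ i)^-1 = t ^+ i by apply: (mulgI (t ^+ i)); rewrite mulgV tXX.
  by rewrite -mulw -wJX conjgE tXV -!mulgA tXX mulg1.
- case: mc => [/natr_Zp_eq1-> | [/negPf-> /natr_Zp_eqN1->]]; last exact: Or31.
  by case: (c); [exact: Or33 | exact: Or32].
Qed.

(** Additivity makes $\alpha_1$ the multiplication by $\mu = \alpha_1(1)$; then $\mu^2 = 1$, and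
    injectivity excludes $\mu = 1$, which leaves $-1$. *)
Lemma injm_Aut_Zp_opp (alpha : {morphism [set: 'Z_2] >-> {perm 'Z_(p ^ 2)}})
    (alpha_inj : 'injm alpha)
    (alpha_aut : alpha @* [set: 'Z_2] \subset Aut [set: 'Z_(p ^ 2)])
    (e : 'Z_2) (g : 'Z_(p ^ 2)) :
  alpha e g = ((-1) ^+ e * g)%R.
Proof.
pose mu := alpha 1%R 1%R.
have alphaE x : alpha 1%R x = (mu * x)%R.
  have [k ->] := Zp_eq_natr x; elim: k => [|k IHk].
    by rewrite mulr0; apply: (addrI (alpha 1%R 0%R)); rewrite -alphaD // !addr0.
  by rewrite -natr1 alphaD // IHk mulrDr mulr1.
have mu2 : (mu * mu = 1)%R.
  rewrite -alphaE -alpha_add //.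
  have -> : (1 + 1 = 0 :> 'Z_2)%R by apply: val_inj.
  exact: alpha_zero.
have mu_neq1 : mu <> 1%R.
  move=> mu1; have : alpha 1%R = alpha 0%R.
    by apply/permP => x; rewrite alphaE mu1 mul1r alpha_zero.
  by move/(injmP alpha_inj) => /(_ (in_setT _) (in_setT _)).
have [m muE] := Zp_eq_natr mu.
have muN1 : mu = (-1)%R.
  have mm : m * m = 1 %[mod p ^ 2].
    move: mu2; rewrite muE -natrM -[RHS](mulr1n 1%R) => /(congr1 (@nat_of_ord _)).
    by rewrite !val_Zp_nat.
  rewrite muE; case: (sqr_mod_prime_sqr p_pr p_gt2 mm) => [/natr_Zp_eq1 m1|].
    by case: mu_neq1; rewrite muE.
  exact: natr_Zp_eqN1.
have -> : e = (val e)%:R%R by rewrite natr_Zp.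
case: (val e) (ltn_ord e : val e < 2) => [|[|//]] _.
  by rewrite alpha_zero mul1r.
by rewrite alphaE muN1.
Qed.

End Models.

(** * Properties of the models and the classification *)

(** The three models share one addition, so cancellation, $E$ and $G$ need a single computation
    each. *)
Lemma model_addI (p : nat) (x y z : ZxZ2 p) :
  model_add x y = model_add x z -> y = z.
Proof.
case: y z => [b j] [c k] e; congr pair; last exact: (congr1 snd e).
by apply: (addrI x.1); exact: (congr1 fst e).
Qed.

Lemma model_idempotents (p : nat) :
  [set x : ZxZ2 p | model_add x x == x] = setX [set 0%R] [set: 'Z_2].
Proof.
apply/setP => [[a i]]; rewrite !inE andbT xpair_eqE eqxx andbT /=.
by rewrite -[X in _ == X]addr0 (inj_eq (addrI a)).
Qed.

Lemma model_add_one (p : nat) :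
  [set model_add x (model_one p) | x in [set: ZxZ2 p]] =
    setX [set: 'Z_(p ^ 2)] [set 0%R].
Proof.
apply/setP => [[a i]]; rewrite !inE /=.
apply/imsetP/eqP => [[x _] /(congr1 snd) // | ->].
by exists (a, 0%R); rewrite ?inE // /model_add /= addr0.
Qed.

Lemma sb_isomorphic_of_bij (B C : leftSemiBraceType) (f : C -> B) :
  bijective f -> {morph f : x y / x [+] y} -> {morph f : x y / x * y} ->
  sb_isomorphic B C.
Proof.
case=> g fK gK fD fM; exists g; split; first by exists f.
  by move=> x y; apply: (can_inj fK); rewrite fD !gK.
by move=> x y; apply: (can_inj fK); rewrite fM !gK.
Qed.

Theorem theorem5p3 (p : nat) (p_pr : prime p) (p_gt2 : (2 < p)%N)
    (alpha : {morphism [set: 'Z_2] >-> {perm 'Z_(p ^ 2)}})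
    (alpha_inj : 'injm alpha)
    (alpha_aut : alpha @* [set: 'Z_2] \subset Aut [set: 'Z_(p ^ 2)])
    (B : finLeftSemiBraceType) (B_canc : left_cancellative B)
    (cardB : #|B| = (2 * p ^ 2)%N) (cardE : #|sb_E B| = 2)
    (cycG : cyclic (sb_G B)) :
  [/\ [/\ left_cancellative (model1 alpha_aut),
          sb_E (model1 alpha_aut) = setX [set 0%R] [set: 'Z_2]
        & sb_G (model1 alpha_aut) = setX [set: 'Z_(p ^ 2)] [set 0%R]],
      [/\ left_cancellative (model2 p),
          sb_E (model2 p) = setX [set 0%R] [set: 'Z_2]
        & sb_G (model2 p) = setX [set: 'Z_(p ^ 2)] [set 0%R]],
      [/\ left_cancellative (model3 p_pr),
          sb_E (model3 p_pr) = setX [set 0%R] [set: 'Z_2]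
        & sb_G (model3 p_pr) = setX [set: 'Z_(p ^ 2)] [set 0%R]]
    & [\/ sb_isomorphic B (model1 alpha_aut), sb_isomorphic B (model2 p)
        | sb_isomorphic B (model3 p_pr)]].
Proof.
split; do ?by split; [exact: model_addI | exact: model_idempotents | exact: model_add_one].
have [f [mu [c [f_bij fD fM]]]] := sb_coordinates p_pr p_gt2 B_canc cardB cardE cycG.
case=> [[muE cE] | [muE cE] | [muE cE]].
- apply: Or31; apply: (sb_isomorphic_of_bij (C := model1 alpha_aut) f_bij) => // x y.
  rewrite -fM; congr f; congr pair.
  by rewrite (injm_Aut_Zp_opp p_pr p_gt2 alpha_inj) // muE cE !(mul0r, mulr0) addr0.
- apply: Or32; apply: (sb_isomorphic_of_bij (C := model2 p) f_bij) => // x y.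
  rewrite -fM; congr f; congr pair.
  by rewrite muE cE expr1n mul1r !(mul0r, mulr0) addr0.
- apply: Or33; apply: (sb_isomorphic_of_bij (C := model3 p_pr) f_bij) => // x y.
  rewrite -fM; congr f; congr pair.
  by rewrite muE cE expr1n !mul1r mulrA.
Qed.
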